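(* Let $L\subset\mathbb{R}^n$ be an $n$-dimensional lattice and let $B=[b_1|\dots|b_n]^t$ be a basis of $L$. Then $$\prod_{i=1}^n\|b_i\|\le e^{1/2}\cdot\left(\frac{S(B)+1}{n}\right)^{\frac{n-1}{2}}\cdot \mathrm{Vol}\,L,$$ where $S(B)$ is the Seysen measure of $B$ and $\mathrm{Vol}\,L$ is the volume of $L$.
   Context: An $n$-dimensional lattice $L\subset\mathbb{R}^n$ is a set $L=\{\sum_{i=1}^n a_i b_i : a_i\in\mathbb{Z}\}$ with $b_1,\dots,b_n\in\mathbb{R}^n$ linearly independent over $\mathbb{R}$. A basis of $L$ is identified with the matrix $B=[b_1|\dots|b_n]^t$ whose rows $b_i$ are linearly independent and generate $L$ over $\mathbb{Z}$. The volume of $L$ is $\mathrm{Vol}\,L=(\det BB^t)^{1/2}$, which does not depend on the choice of basis $B$. The dual basis is $B^*=(B^{-1})^t=[b_1^*|\dots|b_n^*]^t$, so that $\langle b_i,b_j^*\rangle=\delta_{i,j}$. The Seysen measure of $B$ is $S(B)=\sum_{i=1}^n\|b_i\|^2\,\|b_i^*\|^2$, where $\|\cdot\|$ is the Euclidean norm on vectors. *)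

(* Defs.v *)
From mathcomp Require Import all_boot all_order all_algebra.
From mathcomp Require Import classical_sets reals.

Set Implicit Arguments.
Unset Strict Implicit.
Unset Printing Implicit Defensive.

Import Order.TTheory GRing.Theory Num.Theory.

Local Open Scope classical_set_scope.
Local Open Scope ring_scope.

(* The canonical norm on matrices in MathComp-Analysis is the sup norm, hence
   this separate definition. *)
Definition enorm (R : realType) (n : nat) (v : 'rV[R]_n) : R :=
  Num.sqrt (\sum_(j < n) v 0 j ^+ 2).

Definition int_span (R : realType) (n : nat) (B : 'M[R]_n) : set 'rV[R]_n :=
  [set v | exists a : 'I_n -> int, v = \sum_(i < n) (a i)%:~R *: row i B].

(* The basis vectors are the rows of [B]. *)
Definition is_basis (R : realType) (n : nat) (L : set 'rV[R]_n)
    (B : 'M[R]_n) : Prop :=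
  row_free B /\ L = int_span B.

Definition is_lattice (R : realType) (n : nat) (L : set 'rV[R]_n) : Prop :=
  exists B : 'M[R]_n, is_basis L B.

Definition gram_vol (R : realType) (n : nat) (B : 'M[R]_n) : R :=
  Num.sqrt (\det (B *m B^T)).

(* The volume of [L] is computed from an arbitrarily chosen basis; [volE]
   shows that it does not depend on this choice.  The matrix 0 is a junk value
   used only when [L] is not a lattice. *)
Definition vol (R : realType) (n : nat) (L : set 'rV[R]_n) : R :=
  gram_vol (xget 0 [set B : 'M[R]_n | is_basis L B]).

Definition dual_basis (R : realType) (n : nat) (B : 'M[R]_n) : 'M[R]_n :=
  (invmx B)^T.

Definition seysen (R : realType) (n : nat) (B : 'M[R]_n) : R :=
  \sum_(i < n) enorm (row i B) ^+ 2 * enorm (row i (dual_basis B)) ^+ 2.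

Lemma basis_change (R : realType) (n : nat) (L : set 'rV[R]_n)
    (B C : 'M[R]_n) :
  is_basis L B -> is_basis L C ->
  exists U : 'M[int]_n, C = map_mx intr U *m B.
Proof.
move=> [_ LB] [_ LC].
have rowC i : exists a : 'rV[int]_n, row i C == map_mx intr a *m B.
  have : int_span C (row i C).
    exists (fun j => (j == i)%:R); rewrite (bigD1 i) //= eqxx scale1r.
    by rewrite big1 ?addr0 // => j /negPf ->; rewrite scale0r.
  rewrite -LC LB => -[a ->]; exists (\row_j a j); apply/eqP.
  by rewrite mulmx_sum_row; apply: eq_bigr => j _; rewrite !mxE.
exists (\matrix_i xchoose (rowC i)); apply/row_matrixP => i.
by rewrite row_mul -map_row rowK; apply/eqP; exact: (xchooseP (rowC i)).
Qed.

Lemma volE (R : realType) (n : nat) (L : set 'rV[R]_n) (B : 'M[R]_n) :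
  is_basis L B -> vol L = gram_vol B.
Proof.
move=> LB; rewrite /vol; case: xgetP => [C _ LC|/(_ B)//].
have [U CE] := basis_change LB LC; have [V BE] := basis_change LC LB.
have detB : \det B != 0.
  by have [] := LB; rewrite row_free_unit unitmxE unitfE.
have UV : \det V * \det U = 1.
  apply: (@intr_inj R); apply: (mulIf detB).
  by rewrite rmorphM mul1r /= -!det_map_mx -mulrA -!det_mulmx -CE -BE.
have U1 : \det U ^+ 2 = 1.
  have : \det U \is a GRing.unit
    by apply/unitrP; exists (\det V); rewrite [_ * \det V]mulrC.
  by rewrite unfold_in => /orP[] /eqP ->.
rewrite /gram_vol !det_mulmx !det_tr; congr Num.sqrt.
by rewrite CE det_mulmx det_map_mx mulrACA -expr2 -rmorphXn U1 mul1r.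
Qed.

(* Main.v *)
(** Write a_i = ||b_i||^2 and d_i = ||b_i^*||^2.  Replacing the i-th row of the
    dual basis by b_i gives a matrix of determinant a_i / det B, so Hadamard's
    inequality yields a_i <= (det B)^2 * prod_(k != i) d_k, and hence
    prod_k a_k <= (det B)^2 * prod_(k != i) (a_k * d_k).  Multiplying over all i
    and applying AM-GM to the numbers a_k * d_k, whose sum is S(B), gives
    prod_k a_k <= (S(B) / n)^(n-1) * (Vol L)^2, which is stronger than the
    claim. *)
Require Import Defs.
From mathcomp Require Import all_boot all_order all_algebra.
From mathcomp Require Import classical_sets reals sequences exp.

Import Order.TTheory GRing.Theory Num.Theory.

Local Open Scope classical_set_scope.
Local Open Scope ring_scope.

Lemma gram_diagE (R : pzRingType) (m n : nat) (A : 'M[R]_(m, n)) (i : 'I_m) :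
  (A *m A^T) i i = \sum_j A i j ^+ 2.
Proof. by rewrite mxE; apply: eq_bigr => j _; rewrite mxE. Qed.

Lemma gram_diag_ge0 (F : realDomainType) (m n : nat) (A : 'M[F]_(m, n))
    (i : 'I_m) :
  0 <= (A *m A^T) i i.
Proof. by rewrite gram_diagE sumr_ge0 // => j _; exact: sqr_ge0. Qed.

Lemma gram_row0 (F : realDomainType) (n : nat) (v : 'rV[F]_n) :
  (v *m v^T) 0 0 = 0 -> v = 0.
Proof.
rewrite gram_diagE => /eqP; rewrite psumr_eq0 => [/allP v0|j _]; last first.
  exact: sqr_ge0.
apply/rowP => j; apply/eqP; rewrite mxE -sqrf_eq0.
by apply: v0; rewrite mem_index_enum.
Qed.

(* Gram-Schmidt on the first row: subtracting from the other rows their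
   projections on it preserves the determinant of the Gram matrix and shrinks
   its diagonal. *)
Lemma hadamard_gram (F : realFieldType) (m n : nat) (A : 'M[F]_(m, n)) :
  \det (A *m A^T) <= \prod_i (A *m A^T) i i.
Proof.
elim: m A => [|m IHm] A; first by rewrite det_mx00 big_ord0.
rewrite -[m.+1]/(1 + m)%N in A *.
rewrite -[A]vsubmxK; set v := usubmx A; set A' := dsubmx A.
set c := (v *m v^T) 0 0; pose w := A' *m v^T; pose A2 := A' - c^-1 *: (w *m v).
have vvE : v *m v^T = c%:M by rewrite [LHS]mx11_scalar.
have A2v : A2 *m v^T = 0.
  rewrite mulmxBl -scalemxAl -mulmxA vvE mul_mx_scalar scalerA.
  (* If [c = 0] then [v] itself vanishes, so orthogonality survives the convention [0^-1 = 0]. *)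
  have [c0|c_neq0] := eqVneq c 0; last by rewrite mulVf // scale1r subrr.
  by rewrite /w (gram_row0 _ _ _ c0) trmx0 mulmx0 scaler0 subrr.
have A'E : A' = c^-1 *: (w *m v) + A2 by rewrite addrC subrK.
have detL : \det (block_mx 1%:M 0 (c^-1 *: w) 1%:M) = 1 :> F.
  by rewrite det_lblock !det1 mulr1.
have colE : col_mx v A' = block_mx 1%:M 0 (c^-1 *: w) 1%:M *m col_mx v A2.
  by rewrite mul_block_col !mul1mx mul0mx addr0 -scalemxAl -A'E.
have detE : \det (col_mx v A' *m (col_mx v A')^T) = c * \det (A2 *m A2^T).
  rewrite colE trmx_mul mulmxA det_mulmx det_tr detL mulr1 -mulmxA det_mulmx.
  by rewrite detL mul1r tr_col_mx mul_col_row A2v det_ublock vvE det_scalar1.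
(* Pythagoras: the cross terms vanish by [A2v], so passing from [A'] to [A2] removes a nonnegative
   term from each diagonal entry. *)
have diagE i : (A' *m A'^T) i i = c^-1 * (w i 0) ^+ 2 + (A2 *m A2^T) i i.
  have -> : A' *m A'^T = c^-1 *: (w *m w^T) + A2 *m A2^T.
    rewrite {1}A'E mulmxDl -scalemxAl -mulmxA; congr (_ *: (_ *m _) + _).
      by rewrite /w trmx_mul trmxK.
    rewrite A'E linearD linearZ /= trmx_mul mulmxDr -scalemxAr mulmxA A2v.
    by rewrite mul0mx scaler0 add0r.
  by rewrite mxE mxE; congr (_ * _ + _); rewrite gram_diagE big_ord1.
have c_ge0 : 0 <= c by exact: gram_diag_ge0.
rewrite detE tr_col_mx mul_col_row big_split_ord big_ord1 /=.
have -> : block_mx (v *m v^T) (v *m A'^T) (A' *m v^T) (A' *m A'^T)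
    (lshift m 0) (lshift m 0) = c by rewrite block_mxEul.
apply: ler_wpM2l => //; apply: le_trans (IHm A2) _.
apply: ler_prod => i _; rewrite gram_diag_ge0 block_mxEdr diagE lerDr.
by rewrite mulr_ge0 ?invr_ge0 // sqr_ge0.
Qed.

(** In column [i] only the entry [u 0 i] can be nonzero, and its cofactor is the determinant of an
    identity matrix. *)
Lemma det_unit_row (R : comPzRingType) (n : nat) (i : 'I_n) (u : 'rV[R]_n) :
  \det (\matrix_k (if k == i then u else row k 1%:M)) = u 0 i.
Proof.
case: n i u => [[]//|n] i u; rewrite (expand_det_col _ i) (bigD1 i) //=.
rewrite big1 ?addr0 => [|k ki]; last first.
  by rewrite !mxE (negPf ki) !mxE (negPf ki) mul0r.
rewrite !mxE eqxx /cofactor addnn -signr_odd odd_double expr0 mul1r.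
rewrite [X in \det X](_ : _ = 1%:M) ?det1 ?mulr1 //; apply/matrixP => k l.
by rewrite !mxE eq_sym (negPf (neq_lift _ _)) !mxE (inj_eq lift_inj).
Qed.

Lemma gram_dual_le (F : realFieldType) (n : nat) (B D : 'M[F]_n) (i : 'I_n) :
  B *m D^T = 1%:M ->
  (B *m B^T) i i <= \det B ^+ 2 * \prod_(k | k != i) (D *m D^T) k k.
Proof.
move=> BD; set a := (B *m B^T) i i.
have detBD : \det B * \det D = 1 by rewrite -(det_tr D) -det_mulmx BD det1.
have BtD : B^T *m D = 1%:M by rewrite -[LHS]trmxK trmx_mul trmxK mulmx1C ?trmx1.
(* The coordinates of b_i in the dual basis are the inner products of b_i with the b_j, so [E *m D]
   is [D] with row [i] replaced by b_i, and [\det E = a]. *)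
pose E := \matrix_k (if k == i then row i (B *m B^T) else row k 1%:M).
have rowE k : row k (E *m D) = if k == i then row i B else row k D.
  rewrite row_mul rowK; case: ifP => _; last by rewrite -row_mul mul1mx.
  by rewrite -row_mul -mulmxA BtD mulmx1.
have gramE k : (E *m D *m (E *m D)^T) k k =
    if k == i then a else (D *m D^T) k k.
  rewrite gram_diagE; transitivity (\sum_j row k (E *m D) 0 j ^+ 2).
    by apply: eq_bigr => j _; rewrite [in RHS]mxE.
  rewrite rowE; case: ifP => _; rewrite ?/a gram_diagE.
    by apply: eq_bigr => j _; rewrite mxE.
  by apply: eq_bigr => j _; rewrite mxE.
have := hadamard_gram _ _ _ (E *m D).
rewrite (bigD1 i) //= gramE eqxx.
rewrite (eq_bigr (fun k => (D *m D^T) k k)); last first.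
  by move=> k /negPf ki; rewrite gramE ki.
rewrite det_mulmx det_tr -expr2 det_mulmx det_unit_row !mxE -/a.
have aE : \sum_j B i j * B^T j i = a by rewrite /a mxE.
rewrite aE => had.
have : 0 <= a by exact: gram_diag_ge0.
(* Hadamard bounds [(a * \det D) ^+ 2] by [a] times the product over [k != i]. Cancelling one factor
   [a] needs [a > 0]; for [a = 0] only signs matter. *)
rewrite le_eqVlt => /predU1P[<-|a_gt0].
  by rewrite mulr_ge0 ?sqr_ge0 // prodr_ge0 // => k _; exact: gram_diag_ge0.
rewrite -(ler_pM2l a_gt0) mulrCA.
apply: le_trans (ler_wpM2l (sqr_ge0 (\det B)) had).
by rewrite -exprMn mulrCA detBD mulr1 expr2.
Qed.

(** After exchanging the products, each [s k] occurs once for every [i != k]. *)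
Lemma prod_skip1 (R : comPzRingType) (I : finType) (s : I -> R) :
  \prod_i \prod_(k | k != i) s k = (\prod_k s k) ^+ #|I|.-1.
Proof.
rewrite (exchange_big_dep predT) //= -prodrXl; apply: eq_bigr => k _.
rewrite (eq_bigl (predC1 k)) => [|i]; last by rewrite /= eq_sym.
by rewrite prodr_const cardC1.
Qed.

Lemma prod_gram_le (F : realFieldType) (n : nat) (B D : 'M[F]_n) :
  (0 < n)%N -> B *m D^T = 1%:M ->
  \prod_i (B *m B^T) i i <= \det B ^+ 2 *
    ((\sum_i (B *m B^T) i i * (D *m D^T) i i) / n%:R) ^+ n.-1.
Proof.
move=> n_gt0 BD; pose s i := (B *m B^T) i i * (D *m D^T) i i.
have s_ge0 i : 0 <= s i by rewrite mulr_ge0 // gram_diag_ge0.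
have P_ge0 : 0 <= \prod_i (B *m B^T) i i.
  by apply: prodr_ge0 => i _; exact: gram_diag_ge0.
have S_ge0 : 0 <= (\sum_i s i) / n%:R by rewrite divr_ge0 ?sumr_ge0.
have Pi i : \prod_k (B *m B^T) k k <= \det B ^+ 2 * \prod_(k | k != i) s k.
  rewrite (bigD1 i) //= big_split /= mulrCA [leRHS]mulrC; apply: ler_wpM2r.
    by apply: prodr_ge0 => k _; exact: gram_diag_ge0.
  exact: gram_dual_le.
have d_ge0 : 0 <= \det B ^+ 2 by exact: sqr_ge0.
have T_ge0 : 0 <= ((\sum_i s i) / n%:R) ^+ n.-1 by exact: exprn_ge0.
(* The [n]-th power of the left side is bounded by the product of the bounds [Pi i] over all [i]. *)
rewrite -(@ler_pXn2r _ n) ?nnegrE //; last exact: mulr_ge0.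
apply: (@le_trans _ _ (\prod_(i < n) (\det B ^+ 2 * \prod_(k | k != i) s k))).
  rewrite -[X in _ ^+ X]card_ord -prodr_const; apply: ler_prod => i _.
  by rewrite P_ge0 Pi.
rewrite big_split /= prodr_const card_ord prod_skip1 card_ord [leRHS]exprMn.
apply: ler_wpM2l; first exact: exprn_ge0.
(* Swapping the exponents [n.-1] and [n] exposes AM-GM in the form [\prod_i s i <= ((\sum_i s i) /
   n%:R) ^+ n]. *)
rewrite -exprM mulnC exprM; apply: lerXn2r; rewrite ?nnegrE.
- exact: prodr_ge0.
- exact: exprn_ge0.
have := @leif_AGM _ _ predT s; rewrite card_ord => /(_ _)[] //.
Qed.

Lemma enorm_rowE (R : realType) (n : nat) (A : 'M[R]_n) (i : 'I_n) :
  enorm (row i A) ^+ 2 = (A *m A^T) i i.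
Proof.
rewrite gram_diagE sqr_sqrtr; first by apply: eq_bigr => j _; rewrite mxE.
by rewrite sumr_ge0 // => j _; exact: sqr_ge0.
Qed.

Theorem proposition3p5 (R : realType) (n : nat) (hn : (0 < n)%N)
    (L : set 'rV[R]_n) (hL : is_lattice L)
    (B : 'M[R]_n) (hB : is_basis L B) :
  \prod_(i < n) enorm (row i B) <=
    expR (1 / 2) * ((seysen B + 1) / n%:R) `^ ((n%:R - 1) / 2) * vol L.
Proof.
have BD : B *m (dual_basis B)^T = 1%:M.
  by rewrite trmxK mulmxV // -row_free_unit; case: hB.
have S_ge0 : 0 <= seysen B.
  by rewrite sumr_ge0 // => i _; rewrite mulr_ge0 // sqr_ge0.
have T_ge0 : 0 <= (seysen B + 1) / n%:R by rewrite divr_ge0 // addr_ge0.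
have seysenE : seysen B = \sum_i (B *m B^T) i i *
    (dual_basis B *m (dual_basis B)^T) i i.
  by apply: eq_bigr => i _; rewrite !enorm_rowE.
(* Squaring clears the half in the real exponent; since [n > 0], [n%:R - 1] is the cast of
   [n.-1]. *)
have powE : (((seysen B + 1) / n%:R) `^ ((n%:R - 1) / 2)) ^+ 2 =
    ((seysen B + 1) / n%:R) ^+ n.-1.
  rewrite -powR_mulrn ?powR_ge0 // -powRrM divfK ?pnatr_eq0 //.
  by rewrite -powR_mulrn // -subn1 natrB.
have volE2 : vol L ^+ 2 = \det B ^+ 2.
  by rewrite (volE hB) /gram_vol det_mulmx det_tr -expr2 sqr_sqrtr // sqr_ge0.
have vol_ge0 : 0 <= vol L by exact: sqrtr_ge0.
set p := _ `^ _ in powE *; have p_ge0 : 0 <= p by exact: powR_ge0.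
(* The factor [expR (1 / 2)] is at least 1, by [1 + x <= expR x]. *)
apply: (@le_trans _ _ (p * vol L)); last first.
  rewrite -mulrA ler_peMl ?mulr_ge0 //; apply: le_trans (expR_ge1Dx _).
  by rewrite lerDl divr_ge0.
rewrite -(@ler_pXn2r _ 2) ?nnegrE ?mulr_ge0 //; last first.
  by apply: prodr_ge0 => i _; exact: sqrtr_ge0.
rewrite exprMn powE volE2 -prodrXl (eq_bigr _ (fun i _ => enorm_rowE _ _ B i)).
apply: le_trans (prod_gram_le _ _ _ _ hn BD) _.
(* What remains is monotonicity of the power, from [seysen B <= seysen B + 1]. *)
rewrite -seysenE mulrC; apply: ler_wpM2r; first exact: sqr_ge0.
apply: lerXn2r; rewrite ?nnegrE //; first exact: divr_ge0.
by rewrite ler_wpM2r ?invr_ge0 // lerDl.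
Qed.
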